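(* Let $F:\mathcal{K}\to\mathcal{L}$ be a morphism of essentially small tensor triangulated categories, and let $\Phi\subset\mathcal{K}$ and $\Psi\subset\mathcal{L}$ be non-empty sets of objects closed under the $\otimes$-product such that $F(\Phi)\subset\Psi$. Then the map $\operatorname{Spc}(F):\operatorname{Spc}(\mathcal{L})\to\operatorname{Spc}(\mathcal{K})$, $\mathcal{P}\mapsto F^{-1}(\mathcal{P})$, restricts to a map $\mathcal{Z}_{\mathcal{L},\Psi}\to\mathcal{Z}_{\mathcal{K},\Phi}$, the assignment $[f]\mapsto[F(f)]$ is a ring homomorphism $R_{\mathcal{K},\Phi}\to R_{\mathcal{L},\Psi}$, and with the induced map on spectra the diagram $$\begin{array}{ccc}\mathcal{Z}_{\mathcal{L},\Psi}&\xrightarrow{\ \rho_{\mathcal{L},\Psi}\ }&\operatorname{Spec}(R_{\mathcal{L},\Psi})\\ \downarrow&&\downarrow\\ \mathcal{Z}_{\mathcal{K},\Phi}&\xrightarrow{\ \rho_{\mathcal{K},\Phi}\ }&\operatorname{Spec}(R_{\mathcal{K},\Phi})\end{array}$$ is a commutative diagram in the category of spectral spaces (and spectral maps).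
   Context: A tensor triangulated category is a triangulated category $(\mathcal{K},\Sigma)$ with a symmetric monoidal structure $(\otimes,\mathbb{1})$ such that $a\otimes -$ and $-\otimes a$ are exact for every $a$ (with suspension isomorphisms $\Sigma a\otimes b\simeq\Sigma(a\otimes b)\simeq a\otimes\Sigma b$ compatible with the symmetric monoidal structure, and the two isomorphisms $\Sigma a\otimes\Sigma b\simeq\Sigma^2(a\otimes b)$ differing by $-1$). A morphism of tensor triangulated categories is an exact functor that is also a strong (symmetric) $\otimes$-functor, the structure isomorphisms being compatible with each other and with the suspension isomorphisms. $\operatorname{Spc}(\mathcal{K})$ is the set of prime $\otimes$-ideals (proper thick $\otimes$-ideals $\mathcal{P}$ with $a\otimes b\in\mathcal{P}\Rightarrow a\in\mathcal{P}$ or $b\in\mathcal{P}$), with topology having the sets $\operatorname{supp}(a):=\{\mathcal{P}\mid a\notin\mathcal{P}\}$ as a basis of closed sets; it and its closed subspaces are spectral spaces. A spectral map is a continuous map for which preimages of quasi-compact open sets are quasi-compact. For an object $X$, $E_X:=\{f\in[X,X]\mid f\otimes X=X\otimes f\}$, a subring of $[X,X]$. For a non-empty $\otimes$-closed set $\Phi$ of objects, $R_\Phi=R_{\mathcal{K},\Phi}$ is the set of pairs $(X,f)$ with $X\in\Phi$, $f\in E_X$, modulo the smallest equivalence relation with $(X,f)\sim(a\otimes X,a\otimes f)$ and $(X,f)\sim(X\otimes a,f\otimes a)$ for all $a\in\Phi$; the class of $(X,f)$ is $[f]$. It is a commutative ring with $[f_X]+[g_Y]=[f_X\otimes Y+X\otimes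 g_Y]$ and $[f_X][g_Y]=[(f_X\otimes Y)\circ(X\otimes g_Y)]$. $\mathcal{Z}_{\mathcal{K},\Phi}:=\bigcap_{X\in\Phi}\operatorname{supp}(X)$, and $\rho_{\mathcal{K},\Phi}:\mathcal{Z}_{\mathcal{K},\Phi}\to\operatorname{Spec}(R_{\mathcal{K},\Phi})$ is the spectral map $\mathcal{P}\mapsto\{[f]\mid\operatorname{cone}(f)\notin\mathcal{P}\}$. *)

(* Defs.v *)
From HB Require Import structures.
From mathcomp Require Import all_boot all_order all_algebra.
From mathcomp Require Import all_classical.
From mathcomp Require Import topology.
From Stdlib Require Import Relation_Operators.

Set Implicit Arguments.
Unset Strict Implicit.
Unset Printing Implicit Defensive.

Import GRing.Theory.

Local Open Scope classical_set_scope.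
Local Open Scope ring_scope.
Local Open Scope quotient_scope.

Declare Scope tt_scope.
Delimit Scope tt_scope with tt.
Local Open Scope tt_scope.

Reserved Notation "g ∘ f" (at level 40, left associativity).
Reserved Notation "X ⊗ Y" (at level 38, left associativity).
Reserved Notation "f ⊗₁ g" (at level 38, left associativity).

(* Essential smallness is not a separate hypothesis: the objects form a type,
   and subcollections of objects are sets. *)
Record preadditive := Preadditive {
  obj :> Type;
  hom : obj -> obj -> zmodType;
  idm : forall X, hom X X;
  comp : forall X Y Z, hom Y Z -> hom X Y -> hom X Z;
  compA : forall X Y Z W (h : hom Z W) (g : hom Y Z) (f : hom X Y),
    comp h (comp g f) = comp (comp h g) f;
  comp1m : forall X Y (f : hom X Y), comp (idm Y) f = f;
  compm1 : forall X Y (f : hom X Y), comp f (idm X) = f;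
  compDl : forall X Y Z (g g' : hom Y Z) (f : hom X Y),
    comp (g + g') f = comp g f + comp g' f;
  compDr : forall X Y Z (g : hom Y Z) (f f' : hom X Y),
    comp g (f + f') = comp g f + comp g f'
}.

Arguments hom {p} X Y.
Arguments idm {p} X.
Arguments comp {p X Y Z} g f.

Notation "g ∘ f" := (comp g f) : tt_scope.

Section Preadditive.
Context {C : preadditive}.
Implicit Types X Y Z W : C.

Definition iso X Y (f : hom X Y) : Prop :=
  exists g : hom Y X, g ∘ f = idm X /\ f ∘ g = idm Y.

Definition zero_object Z : Prop :=
  forall X, (forall f g : hom X Z, f = g) /\ (forall f g : hom Z X, f = g).

Definition biproduct X Y W (i1 : hom X W) (i2 : hom Y W)
    (p1 : hom W X) (p2 : hom W Y) : Prop :=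
  [/\ p1 ∘ i1 = idm X, p2 ∘ i2 = idm Y, p1 ∘ i2 = 0, p2 ∘ i1 = 0
    & i1 ∘ p1 + i2 ∘ p2 = idm W].

Definition direct_summand X W : Prop :=
  exists Y (i1 : hom X W) (i2 : hom Y W) (p1 : hom W X) (p2 : hom W Y),
    biproduct i1 i2 p1 p2.

End Preadditive.

Record additive := Additive {
  add_pre :> preadditive;
  has_zero_object : exists Z : add_pre, zero_object Z;
  has_biproducts : forall X Y : add_pre,
    exists W (i1 : hom X W) (i2 : hom Y W) (p1 : hom W X) (p2 : hom W Y),
      biproduct i1 i2 p1 p2
}.

(* susp is an additive auto-equivalence.  Verdier's axioms are TR1 (dist_iso,
   dist_id, dist_cone), TR2 (dist_rot), TR3 (dist_mor) and TR4 (dist_oct). *)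
Record triangulated := Triangulated {
  tri_add :> additive;
  susp : tri_add -> tri_add;
  suspm : forall X Y : tri_add, hom X Y -> hom (susp X) (susp Y);
  suspm1 : forall X : tri_add, suspm (idm X) = idm (susp X);
  suspmM : forall (X Y Z : tri_add) (g : hom Y Z) (f : hom X Y),
    suspm (g ∘ f) = suspm g ∘ suspm f;
  suspmD : forall (X Y : tri_add) (f g : hom X Y),
    suspm (f + g) = suspm f + suspm g;
  susp_faithful : forall (X Y : tri_add) (f g : hom X Y),
    suspm f = suspm g -> f = g;
  susp_full : forall (X Y : tri_add) (g : hom (susp X) (susp Y)),
    exists f : hom X Y, suspm f = g;
  susp_ess_surj : forall Y : tri_add,
    exists X, exists f : hom (susp X) Y, iso f;
  dist : forall X Y Z : tri_add,
    hom X Y -> hom Y Z -> hom Z (susp X) -> Prop;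
  dist_iso : forall (X Y Z X' Y' Z' : tri_add)
      (f : hom X Y) (g : hom Y Z) (h : hom Z (susp X))
      (f' : hom X' Y') (g' : hom Y' Z') (h' : hom Z' (susp X'))
      (u : hom X X') (v : hom Y Y') (w : hom Z Z'),
    iso u -> iso v -> iso w ->
    v ∘ f = f' ∘ u -> w ∘ g = g' ∘ v -> suspm u ∘ h = h' ∘ w ->
    dist f g h -> dist f' g' h';
  dist_id : forall X Z : tri_add, zero_object Z ->
    dist (idm X) (0 : hom X Z) (0 : hom Z (susp X));
  dist_cone : forall (X Y : tri_add) (f : hom X Y),
    exists Z (g : hom Y Z) (h : hom Z (susp X)), dist f g h;
  dist_rot : forall (X Y Z : tri_add)
      (f : hom X Y) (g : hom Y Z) (h : hom Z (susp X)),
    dist f g h <-> dist g h (- suspm f);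
  dist_mor : forall (X Y Z X' Y' Z' : tri_add)
      (f : hom X Y) (g : hom Y Z) (h : hom Z (susp X))
      (f' : hom X' Y') (g' : hom Y' Z') (h' : hom Z' (susp X'))
      (u : hom X X') (v : hom Y Y'),
    dist f g h -> dist f' g' h' -> v ∘ f = f' ∘ u ->
    exists w : hom Z Z', w ∘ g = g' ∘ v /\ suspm u ∘ h = h' ∘ w;
  dist_oct : forall (X Y Z Z' X' Y' : tri_add) (f : hom X Y) (g : hom Y Z)
      (u1 : hom Y Z') (w1 : hom Z' (susp X))
      (u2 : hom Z X') (w2 : hom X' (susp Y))
      (u3 : hom Z Y') (w3 : hom Y' (susp X)),
    dist f u1 w1 -> dist g u2 w2 -> dist (g ∘ f) u3 w3 ->
    exists (a : hom Z' Y') (b : hom Y' X'),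
      [/\ a ∘ u1 = u3 ∘ g, w3 ∘ a = w1, b ∘ u3 = u2,
          w2 ∘ b = suspm f ∘ w3 & dist a b (suspm u1 ∘ w2)]
}.

Arguments susp {t} X.
Arguments suspm {t X Y} f.
Arguments dist {t X Y Z} f g h.

(* suspl and suspr are the isomorphisms ΣX ⊗ Y ≅ Σ(X ⊗ Y) ≅ X ⊗ ΣY.  Their
   compatibility with the symmetric monoidal structure consists of one diagram
   for each unitor, one for the symmetry, and one for the associator for each
   position of the suspended factor (suspr_lunit to suspr_assoc); susp_anticomm
   is the sign for ΣX ⊗ ΣY ≅ Σ²(X ⊗ Y). *)
Record tt_category := TTCategory {
  tt_tri :> triangulated;
  tens : tt_tri -> tt_tri -> tt_tri;
  tensm : forall X X' Y Y' : tt_tri,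
    hom X X' -> hom Y Y' -> hom (tens X Y) (tens X' Y');
  unit : tt_tri;
  assoc : forall X Y Z, hom (tens (tens X Y) Z) (tens X (tens Y Z));
  lunit : forall X, hom (tens unit X) X;
  runit : forall X, hom (tens X unit) X;
  braid : forall X Y, hom (tens X Y) (tens Y X);
  tensm1 : forall X Y : tt_tri, tensm (idm X) (idm Y) = idm (tens X Y);
  tensmM : forall (X X' X'' Y Y' Y'' : tt_tri)
      (f : hom X X') (f' : hom X' X'') (g : hom Y Y') (g' : hom Y' Y''),
    tensm (f' ∘ f) (g' ∘ g) = tensm f' g' ∘ tensm f g;
  assoc_iso : forall X Y Z, iso (assoc X Y Z);
  lunit_iso : forall X, iso (lunit X);
  runit_iso : forall X, iso (runit X);
  assoc_nat : forall (X X' Y Y' Z Z' : tt_tri)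
      (f : hom X X') (g : hom Y Y') (h : hom Z Z'),
    assoc X' Y' Z' ∘ tensm (tensm f g) h =
    tensm f (tensm g h) ∘ assoc X Y Z;
  lunit_nat : forall (X X' : tt_tri) (f : hom X X'),
    lunit X' ∘ tensm (idm unit) f = f ∘ lunit X;
  runit_nat : forall (X X' : tt_tri) (f : hom X X'),
    runit X' ∘ tensm f (idm unit) = f ∘ runit X;
  braid_nat : forall (X X' Y Y' : tt_tri) (f : hom X X') (g : hom Y Y'),
    braid X' Y' ∘ tensm f g = tensm g f ∘ braid X Y;
  pentagon : forall X Y Z W,
    assoc X Y (tens Z W) ∘ assoc (tens X Y) Z W =
    tensm (idm X) (assoc Y Z W) ∘ assoc X (tens Y Z) W
      ∘ tensm (assoc X Y Z) (idm W);
  triangle : forall X Y,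
    tensm (idm X) (lunit Y) ∘ assoc X unit Y = tensm (runit X) (idm Y);
  hexagon : forall X Y Z,
    assoc Y Z X ∘ braid X (tens Y Z) ∘ assoc X Y Z =
    tensm (idm Y) (braid X Z) ∘ assoc Y X Z ∘ tensm (braid X Y) (idm Z);
  braidK : forall X Y, braid Y X ∘ braid X Y = idm (tens X Y);
  tensmDl : forall (X X' Y Y' : tt_tri) (f f' : hom X X') (g : hom Y Y'),
    tensm (f + f') g = tensm f g + tensm f' g;
  tensmDr : forall (X X' Y Y' : tt_tri) (f : hom X X') (g g' : hom Y Y'),
    tensm f (g + g') = tensm f g + tensm f g';
  suspl : forall X Y : tt_tri, hom (tens (susp X) Y) (susp (tens X Y));
  suspr : forall X Y : tt_tri, hom (tens X (susp Y)) (susp (tens X Y));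
  suspl_iso : forall X Y, iso (suspl X Y);
  suspr_iso : forall X Y, iso (suspr X Y);
  suspl_nat : forall (X X' Y Y' : tt_tri) (f : hom X X') (g : hom Y Y'),
    suspl X' Y' ∘ tensm (suspm f) g = suspm (tensm f g) ∘ suspl X Y;
  suspr_nat : forall (X X' Y Y' : tt_tri) (f : hom X X') (g : hom Y Y'),
    suspr X' Y' ∘ tensm f (suspm g) = suspm (tensm f g) ∘ suspr X Y;
  tens_exact_r : forall (A X Y Z : tt_tri)
      (f : hom X Y) (g : hom Y Z) (h : hom Z (susp X)),
    dist f g h ->
    dist (tensm (idm A) f) (tensm (idm A) g)
      (suspr A X ∘ tensm (idm A) h);
  tens_exact_l : forall (A X Y Z : tt_tri)
      (f : hom X Y) (g : hom Y Z) (h : hom Z (susp X)),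
    dist f g h ->
    dist (tensm f (idm A)) (tensm g (idm A))
      (suspl X A ∘ tensm h (idm A));
  suspr_lunit : forall X,
    suspm (lunit X) ∘ suspr unit X = lunit (susp X);
  suspl_runit : forall X,
    suspm (runit X) ∘ suspl X unit = runit (susp X);
  susp_braid : forall X Y,
    suspm (braid X Y) ∘ suspl X Y = suspr Y X ∘ braid (susp X) Y;
  suspl_assoc : forall X Y Z,
    suspm (assoc X Y Z) ∘ suspl (tens X Y) Z ∘ tensm (suspl X Y) (idm Z) =
    suspl X (tens Y Z) ∘ assoc (susp X) Y Z;
  susp_mid_assoc : forall X Y Z,
    suspm (assoc X Y Z) ∘ suspl (tens X Y) Z ∘ tensm (suspr X Y) (idm Z) =
    suspr X (tens Y Z) ∘ tensm (idm X) (suspl Y Z) ∘ assoc X (susp Y) Z;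
  suspr_assoc : forall X Y Z,
    suspm (assoc X Y Z) ∘ suspr (tens X Y) Z =
    suspr X (tens Y Z) ∘ tensm (idm X) (suspr Y Z) ∘ assoc X Y (susp Z);
  susp_anticomm : forall X Y,
    suspm (suspl X Y) ∘ suspr (susp X) Y =
    - (suspm (suspr X Y) ∘ suspl X (susp Y))
}.

Arguments tens {t} X Y.
Arguments tensm {t X X' Y Y'} f g.
Arguments unit {t}.
Arguments assoc {t} X Y Z.
Arguments lunit {t} X.
Arguments runit {t} X.
Arguments braid {t} X Y.
Arguments suspl {t} X Y.
Arguments suspr {t} X Y.

Notation "X ⊗ Y" := (tens X Y) : tt_scope.
Notation "f ⊗₁ g" := (tensm f g) : tt_scope.

Record tt_functor (K L : tt_category) := TTFunctor {
  fob :> K -> L;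
  fmor : forall X Y : K, hom X Y -> hom (fob X) (fob Y);
  fmor1 : forall X : K, fmor (idm X) = idm (fob X);
  fmorM : forall (X Y Z : K) (g : hom Y Z) (f : hom X Y),
    fmor (g ∘ f) = fmor g ∘ fmor f;
  fmorD : forall (X Y : K) (f g : hom X Y), fmor (f + g) = fmor f + fmor g;
  fsusp : forall X : K, hom (fob (susp X)) (susp (fob X));
  fsusp_iso : forall X, iso (fsusp X);
  fsusp_nat : forall (X Y : K) (f : hom X Y),
    fsusp Y ∘ fmor (suspm f) = suspm (fmor f) ∘ fsusp X;
  fmor_exact : forall (X Y Z : K)
      (f : hom X Y) (g : hom Y Z) (h : hom Z (susp X)),
    dist f g h -> dist (fmor f) (fmor g) (fsusp X ∘ fmor h);
  ftens : forall X Y : K, hom (fob X ⊗ fob Y) (fob (X ⊗ Y));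
  funit : hom unit (fob unit);
  ftens_iso : forall X Y, iso (ftens X Y);
  funit_iso : iso funit;
  ftens_nat : forall (X X' Y Y' : K) (f : hom X X') (g : hom Y Y'),
    ftens X' Y' ∘ (fmor f ⊗₁ fmor g) = fmor (f ⊗₁ g) ∘ ftens X Y;
  ftens_assoc : forall X Y Z : K,
    fmor (assoc X Y Z) ∘ ftens (X ⊗ Y) Z ∘ (ftens X Y ⊗₁ idm (fob Z)) =
    ftens X (Y ⊗ Z) ∘ (idm (fob X) ⊗₁ ftens Y Z)
      ∘ assoc (fob X) (fob Y) (fob Z);
  ftens_lunit : forall X : K,
    fmor (lunit X) ∘ ftens unit X ∘ (funit ⊗₁ idm (fob X)) = lunit (fob X);
  ftens_runit : forall X : K,
    fmor (runit X) ∘ ftens X unit ∘ (idm (fob X) ⊗₁ funit) = runit (fob X);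
  ftens_braid : forall X Y : K,
    fmor (braid X Y) ∘ ftens X Y = ftens Y X ∘ braid (fob X) (fob Y);
  ftens_suspl : forall X Y : K,
    fsusp (X ⊗ Y) ∘ fmor (suspl X Y) ∘ ftens (susp X) Y =
    suspm (ftens X Y) ∘ suspl (fob X) (fob Y) ∘ (fsusp X ⊗₁ idm (fob Y));
  ftens_suspr : forall X Y : K,
    fsusp (X ⊗ Y) ∘ fmor (suspr X Y) ∘ ftens X (susp Y) =
    suspm (ftens X Y) ∘ suspr (fob X) (fob Y) ∘ (idm (fob X) ⊗₁ fsusp Y)
}.

Arguments fmor {K L} t {X Y} f.

Section Ideals.
Context {K : tt_category}.
Implicit Types (P : set K) (X Y Z : K).

Record thick_ideal P : Prop := ThickIdeal {
  ideal_zero : forall Z, zero_object Z -> P Z;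
  ideal_susp : forall X, P (susp X) <-> P X;
  ideal_cone : forall X Y Z (f : hom X Y) (g : hom Y Z) (h : hom Z (susp X)),
    dist f g h -> P X -> P Y -> P Z;
  ideal_summand : forall X Y, direct_summand X Y -> P Y -> P X;
  ideal_tens : forall X Y, P Y -> P (X ⊗ Y)
}.

Record prime_tt_ideal P : Prop := PrimeTTIdeal {
  prime_thick :> thick_ideal P;
  prime_proper : exists X, ~ P X;
  prime_tens : forall X Y, P (X ⊗ Y) -> P X \/ P Y
}.

End Ideals.

Record Spc (K : tt_category) := MkSpc {
  spc_set :> set K;
  spcP : prime_tt_ideal spc_set
}.

Definition supp (K : tt_category) (X : K) : set (Spc K) :=
  [set P | ~ spc_set P X].

Section PreadditiveTheory.
Context {C : preadditive}.
Implicit Types X Y Z W : C.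

Lemma comp0m X Y Z (f : hom X Y) : (0 : hom Y Z) ∘ f = 0.
Proof. by apply: (addrI (0 ∘ f)); rewrite -compDl !addr0. Qed.

Lemma compm0 X Y Z (f : hom Y Z) : f ∘ (0 : hom X Y) = 0.
Proof. by apply: (addrI (f ∘ 0)); rewrite -compDr !addr0. Qed.

Lemma compNm X Y Z (g : hom Y Z) (f : hom X Y) : (- g) ∘ f = - (g ∘ f).
Proof. by apply: (addrI (g ∘ f)); rewrite -compDl !subrr comp0m. Qed.

Lemma compmN X Y Z (g : hom Y Z) (f : hom X Y) : g ∘ (- f) = - (g ∘ f).
Proof. by apply: (addrI (g ∘ f)); rewrite -compDr !subrr compm0. Qed.

Lemma iso_id X : iso (idm X).
Proof. by exists (idm X); rewrite comp1m. Qed.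

Lemma iso_comp X Y Z (g : hom Y Z) (f : hom X Y) :
  iso g -> iso f -> iso (g ∘ f).
Proof.
move=> [g' [gK g'K]] [f' [fK f'K]]; exists (f' ∘ g'); split.
  by rewrite -compA [g' ∘ _]compA gK comp1m.
by rewrite -compA [f ∘ _]compA f'K comp1m.
Qed.

Lemma iso_monic X Y Z (f : hom Y Z) (g g' : hom X Y) :
  iso f -> f ∘ g = f ∘ g' -> g = g'.
Proof.
by move=> [f' [fK _]] /(congr1 (comp f')); rewrite !compA fK !comp1m.
Qed.

Lemma iso_epic X Y Z (f : hom X Y) (g g' : hom Y Z) :
  iso f -> g ∘ f = g' ∘ f -> g = g'.
Proof.
by move=> [f' [_ fK]] /(congr1 (fun h => h ∘ f')); rewrite -!compA fK !compm1.
Qed.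

Lemma iso_opp X Y (f : hom X Y) : iso f -> iso (- f).
Proof.
by move=> [g [gK fK]]; exists (- g); rewrite !compNm !compmN !opprK.
Qed.

Lemma zero_objectP Z : zero_object Z <-> idm Z = 0.
Proof.
split=> [/(_ Z)[+ _]|Z0 X]; first exact.
split=> f g; first by rewrite -[f]comp1m -[g]comp1m Z0 !comp0m.
by rewrite -[f]compm1 -[g]compm1 Z0 !compm0.
Qed.

End PreadditiveTheory.

Section TriangulatedTheory.
Context {K : triangulated}.
Implicit Types X Y Z W : K.

Lemma suspm0 X Y : suspm (0 : hom X Y) = 0.
Proof. by apply: (addrI (suspm 0)); rewrite -suspmD !addr0. Qed.

Lemma suspmN X Y (f : hom X Y) : suspm (- f) = - suspm f.
Proof. by apply: (addrI (suspm f)); rewrite -suspmD !subrr suspm0. Qed.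

Lemma zero_susp Z : zero_object Z -> zero_object (susp Z).
Proof. by rewrite !zero_objectP => Z0; rewrite -suspm1 Z0 suspm0. Qed.

Lemma dist_comp0 X Y Z (f : hom X Y) (g : hom Y Z) (h : hom Z (susp X)) :
  dist f g h -> g ∘ f = 0.
Proof.
move=> D; have [O ZO] := has_zero_object K.
have [|w [<- _]] := dist_mor (u := idm X) (v := f) (dist_id X ZO) D.
  by [].
by rewrite compm0.
Qed.

Lemma dist_wcoker X Y Z W (f : hom X Y) (g : hom Y Z) (h : hom Z (susp X))
    (k : hom Y W) :
  dist f g h -> k ∘ f = 0 -> exists t : hom Z W, t ∘ g = k.
Proof.
move=> D kf; have [O ZO] := has_zero_object K.
have D' : dist (0 : hom O W) (idm W) (0 : hom W (susp O)).
  apply/dist_rot; rewrite suspm0 oppr0; apply: dist_id; exact: zero_susp.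
have [|w [wg _]] := dist_mor (u := (0 : hom X O)) (v := k) D D'.
  by rewrite kf comp0m.
by exists w; rewrite wg comp1m.
Qed.

Lemma dist_wker X Y Z W (f : hom X Y) (g : hom Y Z) (h : hom Z (susp X))
    (k : hom W Y) :
  dist f g h -> g ∘ k = 0 -> exists t : hom W X, f ∘ t = k.
Proof.
move=> D gk; have [O ZO] := has_zero_object K.
have /dist_rot D' := dist_id W ZO; move/dist_rot: D => D.
have [|w [_ wh]] := dist_mor (u := k) (v := (0 : hom O Z)) D' D.
  by rewrite gk comp0m.
have [t tw] := susp_full w; exists t; apply: susp_faithful.
move: wh; rewrite suspm1 compmN compm1 compNm => /oppr_inj ->.
by rewrite suspmM tw.
Qed.

Lemma split_summand X Y (i : hom X Y) (r : hom Y X) :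
  r ∘ i = idm X -> direct_summand X Y.
Proof.
move=> ri; have [Z [p [h D]]] := dist_cone i.
have pi0 := dist_comp0 D.
have /dist_rot/dist_rot/dist_comp0 := D.
rewrite compNm => /eqP; rewrite oppr_eq0 => /eqP ih.
have h0 : h = 0.
  by rewrite -[h]comp1m -suspm1 -ri suspmM -compA ih compm0.
have [s ps] : exists s, p ∘ s = idm Z.
  move/dist_rot: D => D; apply: (dist_wker D).
  by rewrite h0 comp0m.
pose s' := s - i ∘ (r ∘ s).
have ps' : p ∘ s' = idm Z.
  by rewrite /s' compDr compmN compA pi0 comp0m oppr0 addr0.
have rs' : r ∘ s' = 0.
  by rewrite /s' compDr compmN compA ri comp1m subrr.
exists Z, i, s', r, p; split => //.
pose e := idm Y - i ∘ r - s' ∘ p.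
have pe : p ∘ e = 0.
  rewrite /e !compDr !compmN compm1 !compA pi0 ps' comp0m comp1m oppr0 addr0.
  by rewrite subrr.
have re : r ∘ e = 0.
  rewrite /e !compDr !compmN compm1 !compA ri rs' comp0m comp1m oppr0 addr0.
  by rewrite subrr.
have [t et] := dist_wker D pe.
have t0 : t = 0 by rewrite -[t]comp1m -ri -compA et re.
move: et; rewrite t0 compm0 /e => /esym/eqP.
by rewrite -addrA -opprD subr_eq0 => /eqP.
Qed.

End TriangulatedTheory.

Section IdealTheory.
Context {K : tt_category} {P : set K} (tP : thick_ideal P).
Implicit Types X Y Z : K.

Lemma ideal_split X Y (i : hom X Y) (r : hom Y X) :
  r ∘ i = idm X -> P Y -> P X.
Proof. by move=> /split_summand XY; apply: (ideal_summand tP XY). Qed.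

Lemma ideal_iso X Y (f : hom X Y) : iso f -> P X <-> P Y.
Proof. by move=> [g [gf fg]]; split; [exact: ideal_split fg|exact: ideal_split gf]. Qed.

Lemma ideal_cone0 X Y Z (g : hom Y Z) (h : hom Z (susp X)) :
  dist (0 : hom X Y) g h -> P Z <-> P X /\ P Y.
Proof.
move=> D; split; last by move=> [PX PY]; exact: (ideal_cone tP D).
move=> PZ; split.
  apply/(ideal_susp tP); move/dist_rot/dist_rot: D => D.
  have [|t ht] := dist_wker (k := idm (susp X)) D.
    by rewrite suspm0 oppr0 comp0m.
  exact: ideal_split ht PZ.
have [|t tg] := dist_wcoker (k := idm Y) D; first by rewrite compm0.
exact: ideal_split tg PZ.
Qed.

Lemma ideal_braid X Y : P (X ⊗ Y) <-> P (Y ⊗ X).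
Proof.
by apply: (ideal_iso (f := braid X Y)); exists (braid Y X); rewrite !braidK.
Qed.

Lemma ideal_tensl X Y : P X -> P (X ⊗ Y).
Proof. by move=> PX; apply/ideal_braid; exact: (ideal_tens tP). Qed.

End IdealTheory.

Section SpcTopology.
Context (K : tt_category).

HB.instance Definition _ := gen_eqMixin (Spc K).
HB.instance Definition _ := gen_choiceMixin (Spc K).

(* Opens are unions of complements of supports: {supp X} is a basis of closed
   sets. *)
Definition Spc_open : set_system (Spc K) :=
  [set U | exists S : set K, U = \bigcup_(X in S) ~` supp X].

Lemma Spc_open_setT : Spc_open setT.
Proof.
exists setT; apply/esym; rewrite -subTset => P _.
have [O ZO] := has_zero_object K.
by exists O => //; apply; exact: (ideal_zero (spcP P)).
Qed.

Lemma Spc_open_setI : setI_closed Spc_open.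
Proof.
move=> _ _ [S ->] [T ->].
exists [set Z | exists X Y (g : hom Y Z) (h : hom Z (susp X)),
  [/\ S X, T Y & dist (0 : hom X Y) g h]].
apply/seteqP; split=> [P [[X SX PX] [Y TY PY]]|P [Z [X [Y [g [h [SX TY D]]]]]]].
  have [Z [g [h D]]] := dist_cone (0 : hom X Y).
  exists Z; first by exists X, Y, g, h.
  apply; apply/(ideal_cone0 (spcP P) D).
  by split; apply: contrapT.
move=> /contrapT /(ideal_cone0 (spcP P) D)[PX PY].
by split; [exists X|exists Y] => //; apply.
Qed.

Lemma Spc_open_bigU (I : Type) (f : I -> set (Spc K)) :
  (forall i, Spc_open (f i)) -> Spc_open (\bigcup_i f i).
Proof.
move=> fo; exists [set X | exists i, ~` supp X `<=` f i].
apply/seteqP; split=> P [].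
  move=> i _; have [S fE] := fo i; rewrite fE => -[X SX PX].
  by exists X => //; exists i; rewrite fE => Q QX; exists X.
by move=> X [i sub] PX; exists i => //; exact: sub.
Qed.

HB.instance Definition _ := isOpenTopological.Build (Spc K)
  Spc_open_setT Spc_open_setI Spc_open_bigU.

End SpcTopology.

Record tens_closed (K : tt_category) := TensClosed {
  tset :> set K;
  tset_neq0 : tset !=set0;
  tset_tens : forall X Y, tset X -> tset Y -> tset (X ⊗ Y)
}.

Section TensorTheory.
Context {K : tt_category}.
Implicit Types X Y Z : K.

Lemma tensm0l X X' Y Y' (g : hom Y Y') : (0 : hom X X') ⊗₁ g = 0.
Proof. by apply: (addrI (0 ⊗₁ g)); rewrite -tensmDl !addr0. Qed.

Lemma tensm0r X X' Y Y' (f : hom X X') : f ⊗₁ (0 : hom Y Y') = 0.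
Proof. by apply: (addrI (f ⊗₁ 0)); rewrite -tensmDr !addr0. Qed.

Lemma tensmNl X X' Y Y' (f : hom X X') (g : hom Y Y') :
  (- f) ⊗₁ g = - (f ⊗₁ g).
Proof. by apply: (addrI (f ⊗₁ g)); rewrite -tensmDl !subrr tensm0l. Qed.

Lemma tensmNr X X' Y Y' (f : hom X X') (g : hom Y Y') :
  f ⊗₁ (- g) = - (f ⊗₁ g).
Proof. by apply: (addrI (f ⊗₁ g)); rewrite -tensmDr !subrr tensm0r. Qed.

Lemma tensm_lr X X' Y Y' (f : hom X X') (g : hom Y Y') :
  (f ⊗₁ idm Y') ∘ (idm X ⊗₁ g) = f ⊗₁ g.
Proof. by rewrite -tensmM compm1 comp1m. Qed.

Lemma tensm_rl X X' Y Y' (f : hom X X') (g : hom Y Y') :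
  (idm X' ⊗₁ g) ∘ (f ⊗₁ idm Y) = f ⊗₁ g.
Proof. by rewrite -tensmM compm1 comp1m. Qed.

Lemma braid_iso X Y : iso (braid X Y).
Proof. by exists (braid Y X); rewrite !braidK. Qed.

Lemma tensm_iso X X' Y Y' (f : hom X X') (g : hom Y Y') :
  iso f -> iso g -> iso (f ⊗₁ g).
Proof.
move=> [f' [fK f'K]] [g' [gK g'K]]; exists (f' ⊗₁ g').
by rewrite -!tensmM fK f'K gK g'K !tensm1.
Qed.

Definition Eset X : set (hom X X) := [set f | f ⊗₁ idm X = idm X ⊗₁ f].

Lemma Eset_conj X X' (u : hom X X') (f : hom X X) (f' : hom X' X') :
  iso u -> u ∘ f = f' ∘ u -> Eset f -> Eset f'.
Proof.
move=> u_iso uf Ef; apply: (iso_epic (tensm_iso u_iso u_iso)).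
rewrite -!tensmM -uf !comp1m -[u in LHS]compm1 -[u in RHS]compm1.
by rewrite -compA comp1m !tensmM Ef.
Qed.

Lemma Eset0 X : Eset (0 : hom X X).
Proof. by rewrite /Eset /= tensm0l tensm0r. Qed.

Lemma Eset1 X : Eset (idm X). Proof. by []. Qed.

Lemma EsetD X (f g : hom X X) : Eset f -> Eset g -> Eset (f + g).
Proof. by rewrite /Eset /= tensmDl tensmDr => -> ->. Qed.

Lemma EsetN X (f : hom X X) : Eset f -> Eset (- f).
Proof. by rewrite /Eset /= tensmNl tensmNr => ->. Qed.

Lemma EsetM X (f g : hom X X) : Eset f -> Eset g -> Eset (f ∘ g).
Proof.
rewrite /Eset /= => Ef Eg.
by rewrite -[idm X](compm1 (idm X)) !tensmM Ef Eg.
Qed.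

Lemma Eset_tensl X Y (f : hom X X) : Eset f -> Eset (idm Y ⊗₁ f).
Proof.
move=> Ef; rewrite /Eset /= -tensm1.
pose t := (idm Y ⊗₁ (assoc Y X X ∘ braid X (Y ⊗ X))) ∘ assoc Y X (Y ⊗ X).
have t_iso : iso t.
  apply: iso_comp; last exact: assoc_iso.
  apply: tensm_iso; first exact: iso_id.
  by apply: iso_comp; [exact: assoc_iso|exact: braid_iso].
have t_nat (b d : hom X X) :
    t ∘ ((idm Y ⊗₁ b) ⊗₁ (idm Y ⊗₁ d)) =
    (idm Y ⊗₁ (idm Y ⊗₁ (d ⊗₁ b))) ∘ t.
  rewrite /t -compA assoc_nat !compA -!tensmM.
  congr (_ ∘ _); congr (_ ⊗₁ _).
  by rewrite -compA braid_nat !compA assoc_nat.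
by apply: (iso_monic t_iso); rewrite !t_nat Ef.
Qed.

Lemma Eset_tensr X Y (f : hom X X) : Eset f -> Eset (f ⊗₁ idm Y).
Proof.
move=> /(@Eset_tensl _ Y); apply: (Eset_conj (braid_iso _ _)).
by rewrite braid_nat.
Qed.

End TensorTheory.

Section TensorRing.
Context {K : tt_category} (Phi : tens_closed K).

(* The pairs (X, f) with X in Phi and f in E_X. *)
Record Epair := MkEpair {
  pob : K;
  pobP : tset Phi pob;
  pend : hom pob pob;
  pendP : Eset pend
}.

HB.instance Definition _ := gen_eqMixin Epair.
HB.instance Definition _ := gen_choiceMixin Epair.

Definition Epair_tensl (a : K) (Pa : tset Phi a) (x : Epair) : Epair :=
  MkEpair (tset_tens Pa (pobP x)) (Eset_tensl a (pendP x)).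

Definition Epair_tensr (a : K) (Pa : tset Phi a) (x : Epair) : Epair :=
  MkEpair (tset_tens (pobP x) Pa) (Eset_tensr a (pendP x)).

Inductive Epair_step (x : Epair) : Epair -> Prop :=
| Epair_stepl a (Pa : tset Phi a) : Epair_step x (Epair_tensl Pa x)
| Epair_stepr a (Pa : tset Phi a) : Epair_step x (Epair_tensr Pa x).

Definition Epair_eqv : Epair -> Epair -> Prop :=
  clos_refl_sym_trans Epair Epair_step.

Definition Epair_eqvb : rel Epair := [rel x y | `[< Epair_eqv x y >]].

Lemma Epair_eqvb_refl : reflexive Epair_eqvb.
Proof. by move=> x; apply/asboolP; exact: rst_refl. Qed.

Lemma Epair_eqvb_sym : symmetric Epair_eqvb.
Proof. by move=> x y; apply/asboolP/asboolP; exact: rst_sym. Qed.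

Lemma Epair_eqvb_trans : transitive Epair_eqvb.
Proof.
move=> y x z /asboolP xy /asboolP yz; apply/asboolP; exact: rst_trans xy yz.
Qed.

Canonical Epair_equiv :=
  EquivRel Epair_eqvb Epair_eqvb_refl Epair_eqvb_sym Epair_eqvb_trans.

Definition tensor_ring := {eq_quot Epair_equiv}.

HB.instance Definition _ := Choice.on tensor_ring.
HB.instance Definition _ := EqQuotient.on tensor_ring.

Definition Ecls (x : Epair) : tensor_ring := \pi_tensor_ring x.

Lemma EclsP x y : Ecls x = Ecls y <-> Epair_eqv x y.
Proof. by split=> [/eqmodP/asboolP//|xy]; apply/eqmodP/asboolP. Qed.

Lemma Ecls_repr r : Ecls (repr r) = r.
Proof. exact: reprK. Qed.

Lemma Ecls_tensl a (Pa : tset Phi a) x : Ecls (Epair_tensl Pa x) = Ecls x.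
Proof. by apply/esym/EclsP/rst_step/Epair_stepl. Qed.

Lemma Ecls_tensr a (Pa : tset Phi a) x : Ecls (Epair_tensr Pa x) = Ecls x.
Proof. by apply/esym/EclsP/rst_step/Epair_stepr. Qed.

Lemma Epair_eq X (PX PX' : tset Phi X) (f f' : hom X X)
    (Ef : Eset f) (Ef' : Eset f') :
  f = f' -> MkEpair PX Ef = MkEpair PX' Ef'.
Proof.
move=> ff'; subst f'.
by rewrite (Prop_irrelevance PX PX') (Prop_irrelevance Ef Ef').
Qed.

Lemma Ecls_iso x y (u : hom (pob x) (pob y)) :
  iso u -> u ∘ pend x = pend y ∘ u -> Ecls x = Ecls y.
Proof.
move=> u_iso uxy.
rewrite -(Ecls_tensl (pobP y) x) -(Ecls_tensr (pobP x) y); congr Ecls.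
apply: Epair_eq; apply: (iso_epic (tensm_iso u_iso (iso_id _))).
by rewrite tensm_rl -tensm_lr -(pendP x) -!tensmM uxy.
Qed.

Definition Eadd (x y : Epair) : Epair :=
  MkEpair (tset_tens (pobP x) (pobP y))
    (EsetD (Eset_tensr (pob y) (pendP x)) (Eset_tensl (pob x) (pendP y))).

Definition Emul (x y : Epair) : Epair :=
  MkEpair (tset_tens (pobP x) (pobP y))
    (EsetM (Eset_tensr (pob y) (pendP x)) (Eset_tensl (pob x) (pendP y))).

Definition Eopp (x : Epair) : Epair := MkEpair (pobP x) (EsetN (pendP x)).

Definition Ezero : Epair :=
  MkEpair (projT2 (cid (tset_neq0 Phi))) (Eset0 _).

Definition Eone : Epair :=
  MkEpair (projT2 (cid (tset_neq0 Phi))) (Eset1 _).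

Lemma Eadd_C x y : Ecls (Eadd x y) = Ecls (Eadd y x).
Proof.
apply: (@Ecls_iso (Eadd x y) (Eadd y x) (braid _ _) (braid_iso _ _)) => /=.
by rewrite compDr compDl !braid_nat addrC.
Qed.

Lemma Emul_C x y : Ecls (Emul x y) = Ecls (Emul y x).
Proof.
apply: (@Ecls_iso (Emul x y) (Emul y x) (braid _ _) (braid_iso _ _)) => /=.
by rewrite tensm_lr tensm_lr braid_nat.
Qed.

Lemma Eadd_tensl a (Pa : tset Phi a) x y :
  Ecls (Eadd (Epair_tensl Pa x) y) = Ecls (Eadd x y).
Proof.
rewrite -[RHS](Ecls_tensl Pa).
apply: (@Ecls_iso (Eadd (Epair_tensl Pa x) y) (Epair_tensl Pa (Eadd x y))
  (assoc _ _ _) (assoc_iso _ _ _)) => /=.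
by rewrite -[idm (a ⊗ _)]tensm1 compDr !assoc_nat tensmDr compDl.
Qed.

Lemma Emul_tensl a (Pa : tset Phi a) x y :
  Ecls (Emul (Epair_tensl Pa x) y) = Ecls (Emul x y).
Proof.
rewrite -[RHS](Ecls_tensl Pa).
apply: (@Ecls_iso (Emul (Epair_tensl Pa x) y) (Epair_tensl Pa (Emul x y))
  (assoc _ _ _) (assoc_iso _ _ _)) => /=.
by rewrite !tensm_lr assoc_nat.
Qed.

Lemma Epair_tens_lr a (Pa : tset Phi a) x :
  exists2 u : hom (pob (Epair_tensr Pa x)) (pob (Epair_tensl Pa x)),
    iso u & u ∘ pend (Epair_tensr Pa x) = pend (Epair_tensl Pa x) ∘ u.
Proof. by exists (braid _ _); [exact: braid_iso|rewrite braid_nat]. Qed.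

Lemma Eadd_iso x x' y (u : hom (pob x) (pob x')) :
  iso u -> u ∘ pend x = pend x' ∘ u -> Ecls (Eadd x y) = Ecls (Eadd x' y).
Proof.
move=> u_iso uxx'.
apply: (@Ecls_iso (Eadd x y) (Eadd x' y) (u ⊗₁ idm (pob y))) => /=.
  by apply: tensm_iso => //; exact: iso_id.
by rewrite compDr compDl -!tensmM uxx' !comp1m !compm1.
Qed.

Lemma Emul_iso x x' y (u : hom (pob x) (pob x')) :
  iso u -> u ∘ pend x = pend x' ∘ u -> Ecls (Emul x y) = Ecls (Emul x' y).
Proof.
move=> u_iso uxx'.
apply: (@Ecls_iso (Emul x y) (Emul x' y) (u ⊗₁ idm (pob y))) => /=.
  by apply: tensm_iso => //; exact: iso_id.
by rewrite !tensm_lr -!tensmM uxx' !comp1m !compm1.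
Qed.

Lemma Eadd_eqv x x' y :
  Epair_eqv x x' -> Ecls (Eadd x y) = Ecls (Eadd x' y).
Proof.
elim=> [z _ [] a Pa|//|//|z z' z'' _ -> _ ->] //.
  by rewrite Eadd_tensl.
have [u u_iso uE] := Epair_tens_lr Pa z.
by rewrite (Eadd_iso _ u_iso uE) Eadd_tensl.
Qed.

Lemma Emul_eqv x x' y :
  Epair_eqv x x' -> Ecls (Emul x y) = Ecls (Emul x' y).
Proof.
elim=> [z _ [] a Pa|//|//|z z' z'' _ -> _ ->] //.
  by rewrite Emul_tensl.
have [u u_iso uE] := Epair_tens_lr Pa z.
by rewrite (Emul_iso _ u_iso uE) Emul_tensl.
Qed.

Lemma Eopp_eqv x x' : Epair_eqv x x' -> Ecls (Eopp x) = Ecls (Eopp x').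
Proof.
elim=> [z _ [] a Pa|//|//|z z' z'' _ -> _ ->] //.
  rewrite -(Ecls_tensl Pa); congr Ecls; apply: Epair_eq => /=.
  by rewrite tensmNr.
rewrite -(Ecls_tensr Pa); congr Ecls; apply: Epair_eq => /=.
by rewrite tensmNl.
Qed.

Definition radd (r s : tensor_ring) := Ecls (Eadd (repr r) (repr s)).
Definition rmul (r s : tensor_ring) := Ecls (Emul (repr r) (repr s)).
Definition ropp (r : tensor_ring) := Ecls (Eopp (repr r)).

Lemma repr_eqv x : Epair_eqv (repr (Ecls x)) x.
Proof. by apply/EclsP; rewrite Ecls_repr. Qed.

Lemma radd_cls x y : radd (Ecls x) (Ecls y) = Ecls (Eadd x y).
Proof.
rewrite /radd (Eadd_eqv _ (repr_eqv x)) Eadd_C (Eadd_eqv _ (repr_eqv y)).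
exact: Eadd_C.
Qed.

Lemma rmul_cls x y : rmul (Ecls x) (Ecls y) = Ecls (Emul x y).
Proof.
rewrite /rmul (Emul_eqv _ (repr_eqv x)) Emul_C (Emul_eqv _ (repr_eqv y)).
exact: Emul_C.
Qed.

Lemma ropp_cls x : ropp (Ecls x) = Ecls (Eopp x).
Proof. exact: Eopp_eqv (repr_eqv x). Qed.

Section CommonObject.
Variables (X : K) (PX : tset Phi X).
Implicit Types f g : hom X X.

Lemma Ecls_add f g (Ef : Eset f) (Eg : Eset g) :
  radd (Ecls (MkEpair PX Ef)) (Ecls (MkEpair PX Eg)) =
  Ecls (MkEpair PX (EsetD Ef Eg)).
Proof.
rewrite radd_cls -[RHS](Ecls_tensr PX); congr Ecls; apply: Epair_eq => /=.
by rewrite tensmDl -Eg.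
Qed.

Lemma Ecls_mul f g (Ef : Eset f) (Eg : Eset g) :
  rmul (Ecls (MkEpair PX Ef)) (Ecls (MkEpair PX Eg)) =
  Ecls (MkEpair PX (EsetM Ef Eg)).
Proof.
rewrite rmul_cls -[RHS](Ecls_tensr PX); congr Ecls; apply: Epair_eq => /=.
by rewrite -[idm X in RHS](compm1 (idm X)) tensmM -Eg.
Qed.

Lemma Ecls_zero : Ecls (MkEpair PX (Eset0 X)) = Ecls Ezero.
Proof.
rewrite -[LHS](Ecls_tensl (pobP Ezero)) -(Ecls_tensr PX Ezero); congr Ecls.
by apply: Epair_eq => /=; rewrite tensm0l tensm0r.
Qed.

Lemma Ecls_one : Ecls (MkEpair PX (Eset1 X)) = Ecls Eone.
Proof.
rewrite -[LHS](Ecls_tensl (pobP Eone)) -(Ecls_tensr PX Eone); congr Ecls.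
exact: Epair_eq.
Qed.

End CommonObject.

(* Finitely many classes are represented on a common object, which reduces the
   ring axioms to those of the rings Eset X. *)
Lemma common3 (r s t : tensor_ring) : exists X (PX : tset Phi X) (f g h : hom X X)
    (Ef : Eset f) (Eg : Eset g) (Eh : Eset h),
  [/\ r = Ecls (MkEpair PX Ef), s = Ecls (MkEpair PX Eg)
    & t = Ecls (MkEpair PX Eh)].
Proof.
pose x := repr r; pose y := repr s; pose z := repr t.
pose X := (pob x ⊗ pob y) ⊗ pob z.
have PX : tset Phi X.
  by apply: tset_tens; [apply: tset_tens|]; exact: pobP.
exists X, PX.
exists ((pend x ⊗₁ idm (pob y)) ⊗₁ idm (pob z)).
exists ((idm (pob x) ⊗₁ pend y) ⊗₁ idm (pob z)).
exists (idm (pob x ⊗ pob y) ⊗₁ pend z).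
exists (Eset_tensr (pob z) (Eset_tensr (pob y) (pendP x))).
exists (Eset_tensr (pob z) (Eset_tensl (pob x) (pendP y))).
exists (Eset_tensl (pob x ⊗ pob y) (pendP z)); split.
- rewrite -[LHS]Ecls_repr -/x -(Ecls_tensr (pobP y)) -(Ecls_tensr (pobP z)).
  by congr Ecls; apply: Epair_eq.
- rewrite -[LHS]Ecls_repr -/y -(Ecls_tensl (pobP x)) -(Ecls_tensr (pobP z)).
  by congr Ecls; apply: Epair_eq.
- rewrite -[LHS]Ecls_repr -/z.
  rewrite -(Ecls_tensl (tset_tens (pobP x) (pobP y))).
  by congr Ecls; apply: Epair_eq.
Qed.

Lemma raddA : associative radd.
Proof.
move=> r s t; have [X [PX [f [g [h [Ef [Eg [Eh [-> -> ->]]]]]]]]] := common3 r s t.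
by rewrite !Ecls_add; congr Ecls; apply: Epair_eq; rewrite addrA.
Qed.

Lemma raddC : commutative radd.
Proof. by move=> r s; exact: Eadd_C. Qed.

Lemma radd0 : left_id (Ecls Ezero) radd.
Proof.
move=> r; have [X [PX [f [_ [_ [Ef [_ [_ [-> _ _]]]]]]]]] := common3 r r r.
rewrite -(Ecls_zero PX) Ecls_add; congr Ecls; apply: Epair_eq.
by rewrite add0r.
Qed.

Lemma raddN : left_inverse (Ecls Ezero) ropp radd.
Proof.
move=> r; have [X [PX [f [_ [_ [Ef [_ [_ [-> _ _]]]]]]]]] := common3 r r r.
rewrite ropp_cls Ecls_add -(Ecls_zero PX); congr Ecls; apply: Epair_eq.
by rewrite addNr.
Qed.

Lemma rmulA : associative rmul.
Proof.
move=> r s t; have [X [PX [f [g [h [Ef [Eg [Eh [-> -> ->]]]]]]]]] := common3 r s t.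
by rewrite !Ecls_mul; congr Ecls; apply: Epair_eq; rewrite compA.
Qed.

Lemma rmulC : commutative rmul.
Proof. by move=> r s; exact: Emul_C. Qed.

Lemma rmul1 : left_id (Ecls Eone) rmul.
Proof.
move=> r; have [X [PX [f [_ [_ [Ef [_ [_ [-> _ _]]]]]]]]] := common3 r r r.
rewrite -(Ecls_one PX) Ecls_mul; congr Ecls; apply: Epair_eq.
by rewrite comp1m.
Qed.

Lemma rmulDl : left_distributive rmul radd.
Proof.
move=> r s t; have [X [PX [f [g [h [Ef [Eg [Eh [-> -> ->]]]]]]]]] := common3 r s t.
rewrite !Ecls_add !Ecls_mul Ecls_add; congr Ecls; apply: Epair_eq.
by rewrite compDl.
Qed.

HB.instance Definition _ :=
  GRing.isZmodule.Build tensor_ring raddA raddC radd0 raddN.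
HB.instance Definition _ :=
  GRing.Zmodule_isComPzRing.Build tensor_ring rmulA rmulC rmul1 rmulDl.

Lemma EclsD x y : Ecls x + Ecls y = Ecls (Eadd x y).
Proof. exact: radd_cls. Qed.

Lemma EclsM x y : Ecls x * Ecls y = Ecls (Emul x y).
Proof. exact: rmul_cls. Qed.

Lemma Ecls0 X (PX : tset Phi X) : Ecls (MkEpair PX (Eset0 X)) = 0.
Proof. exact: Ecls_zero. Qed.

Lemma Ecls1 X (PX : tset Phi X) : Ecls (MkEpair PX (Eset1 X)) = 1.
Proof. exact: Ecls_one. Qed.

End TensorRing.

(* tensor_ring is the zero ring as soon as Phi contains a zero object, so prime
   ideals are needed over rings that may be trivial. *)

Record prime_ring_ideal (R : comPzRingType) (I : set R) : Prop :=
  PrimeRingIdeal {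
    pideal0 : I 0;
    pidealD : forall r s, I r -> I s -> I (r + s);
    pidealMl : forall r s, I s -> I (r * s);
    pideal1 : ~ I 1;
    pidealM : forall r s, I (r * s) -> I r \/ I s
  }.

Record Spec (R : comPzRingType) := MkSpec {
  spec_set :> set R;
  specP : prime_ring_ideal spec_set
}.

Section SpecTopology.
Context (R : comPzRingType).

HB.instance Definition _ := gen_eqMixin (Spec R).
HB.instance Definition _ := gen_choiceMixin (Spec R).

Definition Spec_open : set_system (Spec R) :=
  [set U | exists S : set R, U = \bigcup_(r in S) [set p | ~ spec_set p r]].

Lemma Spec_open_setT : Spec_open setT.
Proof.
exists setT; apply/esym; rewrite -subTset => p _.
by exists 1 => //; exact: (pideal1 (specP p)).
Qed.

Lemma Spec_open_setI : setI_closed Spec_open.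
Proof.
move=> _ _ [S ->] [T ->].
exists [set t | exists r s, [/\ S r, T s & t = r * s]].
apply/seteqP; split=> [p [[r Sr pr] [s Ts ps]]|p [_ [r [s [Sr Ts ->]]] prs]].
  by exists (r * s); [exists r, s|move=> /(pidealM (specP p))[]].
split; [exists r => // pr|exists s => // ps]; apply: prs.
  by rewrite mulrC; exact: (pidealMl (specP p)).
exact: (pidealMl (specP p)).
Qed.

Lemma Spec_open_bigU (I : Type) (f : I -> set (Spec R)) :
  (forall i, Spec_open (f i)) -> Spec_open (\bigcup_i f i).
Proof.
move=> fo; exists [set r | exists i, [set p | ~ spec_set p r] `<=` f i].
apply/seteqP; split=> p [].
  move=> i _; have [S fE] := fo i; rewrite fE => -[r Sr pr].
  by exists r => //; exists i; rewrite fE => q qr; exists r.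
by move=> r [i sub] pr; exists i => //; exact: sub.
Qed.

HB.instance Definition _ := isOpenTopological.Build (Spec R)
  Spec_open_setT Spec_open_setI Spec_open_bigU.

End SpecTopology.

Lemma Spec_map_prime (R S : comPzRingType) (h : {rmorphism R -> S})
  (p : Spec S) : prime_ring_ideal (h @^-1` spec_set p).
Proof.
have pP := specP p; split=> /=.
- by rewrite rmorph0; exact: pideal0 pP.
- by move=> r s; rewrite rmorphD; exact: (pidealD pP).
- by move=> r s; rewrite rmorphM; exact: (pidealMl pP).
- by rewrite rmorph1; exact: pideal1 pP.
- by move=> r s; rewrite rmorphM; exact: (pidealM pP).
Qed.

Definition Spec_map (R S : comPzRingType) (h : {rmorphism R -> S})
  (p : Spec S) : Spec R := MkSpec (Spec_map_prime h p).

Section Spectral.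
Implicit Types T : topologicalType.

Definition irreducible_closed T (C : set T) : Prop :=
  [/\ closed C, C !=set0
    & forall A B : set T, closed A -> closed B ->
        C `<=` A `|` B -> C `<=` A \/ C `<=` B].

(* compact does not include Hausdorff. *)
Definition qc_open T (U : set T) : Prop := open U /\ compact U.

Definition spectral_space T : Prop :=
  [/\ compact [set: T],
      forall U V : set T, qc_open U -> qc_open V -> qc_open (U `&` V),
      forall (U : set T) x, open U -> U x ->
        exists V : set T, [/\ qc_open V, V x & V `<=` U]
    & forall C : set T, irreducible_closed C ->
        exists! x : T, closure [set x] = C].

Definition spectral_map (T T' : topologicalType) (f : T -> T') : Prop :=
  continuous f /\ forall U : set T', qc_open U -> qc_open (f @^-1` U).

End Spectral.

Definition cone {K : triangulated} {X Y : K} (f : hom X Y) : K :=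
  projT1 (cid (dist_cone f)).

Definition Zset (K : tt_category) (Phi : set K) : set (Spc K) :=
  \bigcap_(X in Phi) supp X.

Section Cone.
Context {K : tt_category} {P : set K} (tP : thick_ideal P).
Implicit Types X Y Z : K.

Lemma cone_dist X Y (f : hom X Y) :
  exists (g : hom Y (cone f)) (h : hom (cone f) (susp X)), dist f g h.
Proof. exact: (projT2 (cid (dist_cone f))). Qed.

Lemma ideal_dist2 X Y Z (f : hom X Y) (g : hom Y Z) (h : hom Z (susp X)) :
  dist f g h -> P X -> P Z -> P Y.
Proof.
move=> /dist_rot/dist_rot D PX PZ; apply/(ideal_susp tP).
by apply: (ideal_cone tP D) => //; apply/(ideal_susp tP).
Qed.

Lemma ideal_cone_id X Z (g : hom X Z) (h : hom Z (susp X)) :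
  dist (idm X) g h -> P Z.
Proof.
move=> D; apply: (ideal_zero tP); apply/zero_objectP.
have g0 : g = 0 by rewrite -[g]compm1 (dist_comp0 D).
have D' := (dist_rot _ _ _).1 D.
have h0 : h = 0.
  have /dist_rot/dist_comp0 := D'.
  by rewrite suspm1 compNm comp1m => /eqP; rewrite oppr_eq0 => /eqP.
have [|t] := dist_wker (k := idm Z) D'; first by rewrite h0 comp0m.
by rewrite g0 comp0m => ->.
Qed.

Lemma ideal_cone_comp X Y Z (f : hom X Y) (g : hom Y Z) :
  P (cone f) -> P (cone g) -> P (cone (g ∘ f)).
Proof.
have [u1 [w1 D1]] := cone_dist f; have [u2 [w2 D2]] := cone_dist g.
have [u3 [w3 D3]] := cone_dist (g ∘ f).
have [a [b [_ _ _ _ D]]] := dist_oct D1 D2 D3.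
exact: ideal_dist2 D.
Qed.

Lemma ideal_coneE X Y Z (f : hom X Y) (g : hom Y Z) (h : hom Z (susp X)) :
  dist f g h -> P (cone f) <-> P Z.
Proof.
move=> D; have [g' [h' D']] := cone_dist f.
have [O [u [v D0]]] := dist_cone (idm X).
have O0 := ideal_cone_id D0.
have fE : f = f ∘ idm X by rewrite compm1.
split=> PZ.
  have DC := D; rewrite fE in DC; have [a [b [_ _ _ _ Dab]]] := dist_oct D0 D' DC.
  exact: ideal_dist2 Dab _ _.
have DC := D'; move: (cone f) g' h' D' DC PZ => C g' h' D' DC PZ.
rewrite fE in DC; have [a [b [_ _ _ _ Dab]]] := dist_oct D0 D DC.
exact: ideal_dist2 Dab _ _.
Qed.

Lemma ideal_cone_zero X : P (cone (0 : hom X X)) <-> P X.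
Proof.
have [g [h D]] := cone_dist (0 : hom X X).
by rewrite (ideal_cone0 tP D); split=> [[]|].
Qed.

Lemma ideal_cone_tensl A X (f : hom X X) :
  P (cone (idm A ⊗₁ f)) <-> P (A ⊗ cone f).
Proof.
have [g [h D]] := cone_dist f; exact: (ideal_coneE (tens_exact_r A D)).
Qed.

Lemma ideal_cone_tensr A X (f : hom X X) :
  P (cone (f ⊗₁ idm A)) <-> P (cone f ⊗ A).
Proof.
have [g [h D]] := cone_dist f; exact: (ideal_coneE (tens_exact_l A D)).
Qed.

End Cone.

Section Nilpotence.
Context {K : tt_category}.
Implicit Types X A B : K.

Lemma Eset_cone_nil X (f : hom X X) :
  Eset f -> (f ∘ f) ⊗₁ idm (cone f) = 0.
Proof.
move=> Ef; have [p [q D]] := cone_dist f.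
have pf := dist_comp0 D.
have fq : suspm f ∘ q = 0.
  have /dist_rot/dist_rot/dist_comp0 := D.
  by rewrite compNm => /eqP; rewrite oppr_eq0 => /eqP.
have /dist_rot DX := tens_exact_r X D.
have k0 : (f ⊗₁ idm (cone f)) ∘ (idm X ⊗₁ p) = 0.
  by rewrite tensm_lr -tensm_rl Ef -tensmM pf tensm0r.
have [u uE] := dist_wcoker DX k0.
have -> : (f ∘ f) ⊗₁ idm (cone f) =
    (f ⊗₁ idm (cone f)) ∘ (f ⊗₁ idm (cone f)).
  by rewrite -tensmM compm1.
rewrite -{1}uE -!compA tensm_rl -tensm_lr.
rewrite [suspr _ _ ∘ _]compA -suspm1 suspr_nat Ef -suspr_nat.
by rewrite -compA -tensmM fq tensm0r !compm0.
Qed.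

Lemma tensm_nill X (k : hom X X) A B :
  k ⊗₁ idm A = 0 -> k ⊗₁ idm (A ⊗ B) = 0.
Proof.
move=> kA; apply: (iso_epic (assoc_iso X A B)).
by rewrite -tensm1 -assoc_nat kA tensm0l compm0 comp0m.
Qed.

Lemma tensm_nilr X (k : hom X X) A B :
  k ⊗₁ idm B = 0 -> k ⊗₁ idm (A ⊗ B) = 0.
Proof.
move=> /(@tensm_nill _ _ _ A) kBA.
have u_iso := tensm_iso (iso_id X) (braid_iso A B).
apply: (iso_monic u_iso).
by rewrite tensm_rl -tensm_lr kBA comp0m compm0.
Qed.

End Nilpotence.

Section Rho.
Context {K : tt_category} (Phi : tens_closed K).

Definition rho_set (P : set K) : set (tensor_ring Phi) :=
  [set r | exists2 x : Epair Phi, ~ P (cone (pend x)) & r = Ecls x].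

Context {P : set K} (pP : prime_tt_ideal P).
Hypothesis PhiP : forall X, tset Phi X -> ~ P X.

Lemma cone_eqv (x y : Epair Phi) : Epair_eqv x y ->
  P (cone (pend x)) <-> P (cone (pend y)).
Proof.
elim=> {x y} [x _ [] a Pa|//|x y _ ->|x y z _ -> _ ->] //=.
  rewrite (ideal_cone_tensl pP); split; first exact: (ideal_tens pP).
  by move=> /(prime_tens pP)[/(PhiP Pa)|].
rewrite (ideal_cone_tensr pP); split; first exact: (ideal_tensl pP).
by move=> /(prime_tens pP)[|/(PhiP Pa)].
Qed.

Lemma rho_setE (x : Epair Phi) : rho_set P (Ecls x) <-> ~ P (cone (pend x)).
Proof.
by split=> [[y Py /EclsP/cone_eqv ->]|Px] //; exists x.
Qed.

Lemma common2_comm (r s : tensor_ring Phi) :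
  exists X (PX : tset Phi X) (f g : hom X X) (Ef : Eset f) (Eg : Eset g),
  [/\ f ∘ g = g ∘ f, r = Ecls (MkEpair PX Ef) & s = Ecls (MkEpair PX Eg)].
Proof.
have [X [PX [f [g [_ [Ef [Eg [_ [-> -> _]]]]]]]]] := common3 r s 0.
exists (X ⊗ X), (tset_tens PX PX), _, _, (Eset_tensr X Ef), (Eset_tensr X Eg).
split; try by rewrite -(Ecls_tensr PX).
by rewrite Eg tensm_lr -tensm_rl -Eg.
Qed.

Lemma cone_factor X (f g : hom X X) :
  Eset g -> f ∘ g = g ∘ f -> tset Phi X ->
  P (cone (f ∘ g)) -> P (cone g).
Proof.
move=> Eg fg PX Pfg; pose D := cone g.
have PD : P (cone ((f ∘ g) ⊗₁ idm D)).
  by apply/(ideal_cone_tensr pP)/(ideal_tensl pP).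
have := ideal_cone_comp pP PD PD.
have -> : (f ∘ g) ⊗₁ idm D ∘ (f ∘ g) ⊗₁ idm D = 0.
  rewrite -tensmM -compA [g ∘ (f ∘ g)]compA -fg -[f ∘ g ∘ g]compA compA.
  by rewrite tensmM (Eset_cone_nil Eg) compm0.
by rewrite (ideal_cone_zero pP) => /(prime_tens pP)[/(PhiP PX)|].
Qed.

Lemma cone_add X (f g : hom X X) :
  Eset f -> Eset g -> f ∘ g = g ∘ f -> tset Phi X ->
  P (cone (f + g)) -> P (cone f) \/ P (cone g).
Proof.
move=> Ef Eg fg PX; set h := f + g => Ph; pose A := cone f ⊗ cone g.
have f2 : (f ∘ f) ⊗₁ idm A = 0 by exact/tensm_nill/Eset_cone_nil.
have g2 : (g ∘ g) ⊗₁ idm A = 0 by exact/tensm_nilr/Eset_cone_nil.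
have PA : P (cone (h ⊗₁ idm A)).
  by apply/(ideal_cone_tensr pP)/(ideal_tensl pP).
have := ideal_cone_comp pP (ideal_cone_comp pP PA PA) PA.
have -> : h ⊗₁ idm A ∘ (h ⊗₁ idm A ∘ h ⊗₁ idm A) = 0.
  have -> : h ⊗₁ idm A ∘ h ⊗₁ idm A = (f ∘ g + f ∘ g) ⊗₁ idm A.
    rewrite -tensmM /h compDl !compDr !tensmDl !compm1 f2 g2 add0r addr0.
    by rewrite -fg.
  have ffg : (f ∘ (f ∘ g)) ⊗₁ idm A = 0.
    by rewrite compA -[idm A]compm1 tensmM f2 comp0m.
  have gfg : (g ∘ (f ∘ g)) ⊗₁ idm A = 0.
    by rewrite fg compA -[idm A]compm1 tensmM g2 comp0m.
  by rewrite -tensmM /h compDl !compDr !tensmDl compm1 ffg gfg !addr0.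
rewrite (ideal_cone_zero pP) => /(prime_tens pP)[/(PhiP PX)//|].
exact: (prime_tens pP).
Qed.

Lemma rho_prime : prime_ring_ideal (rho_set P).
Proof.
split.
- have [X PX] := tset_neq0 Phi.
  rewrite -(Ecls0 PX) rho_setE /= (ideal_cone_zero pP); exact: PhiP.
- move=> r s; have [X [PX [f [g [Ef [Eg [fg -> ->]]]]]]] := common2_comm r s.
  rewrite [_ + _]Ecls_add !rho_setE /= => Pf Pg /(cone_add Ef Eg fg PX)[] //.
- move=> r s; have [X [PX [f [g [Ef [Eg [fg -> ->]]]]]]] := common2_comm r s.
  rewrite [_ * _]Ecls_mul !rho_setE /= => Pg /(cone_factor Eg fg PX) //.
- have [X PX] := tset_neq0 Phi.
  rewrite -(Ecls1 PX) rho_setE /=; apply.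
  by have [g [h D]] := cone_dist (idm X); exact: (ideal_cone_id pP D).
- move=> r s; have [X [PX [f [g [Ef [Eg [fg -> ->]]]]]]] := common2_comm r s.
  rewrite [_ * _]Ecls_mul !rho_setE /= => Pfg; apply: contrapT => /not_orP[].
  move=> /contrapT Pf /contrapT Pg; by apply: Pfg; apply: (ideal_cone_comp pP).
Qed.

End Rho.

Lemma Zset_notin (K : tt_category) (Phi : set K) (P : Zset Phi) (X : K) :
  Phi X -> ~ spc_set (set_val P) X.
Proof. by move=> PX; exact: (set_mem (valP P)). Qed.

Definition rho (K : tt_category) (Phi : tens_closed K) (P : Zset Phi) :
    Spec (tensor_ring Phi) :=
  MkSpec (rho_prime (spcP (set_val P)) (@Zset_notin K Phi P)).

Section Functor.
Context {K L : tt_category} (F : tt_functor K L).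
Implicit Types X Y Z : K.

Lemma fmor0 X Y : fmor F (0 : hom X Y) = 0.
Proof. by apply: (addrI (fmor F 0)); rewrite -fmorD !addr0. Qed.

Lemma fmor_zero Z : zero_object Z -> zero_object (F Z).
Proof. by rewrite !zero_objectP => Z0; rewrite -fmor1 Z0 fmor0. Qed.

Lemma fmor_summand X Y : direct_summand X Y -> direct_summand (F X) (F Y).
Proof.
move=> [Z [i [j [p [q [pi qj pj qi pq]]]]]].
exists (F Z), (fmor F i), (fmor F j), (fmor F p), (fmor F q).
by split; rewrite -!fmorM -?fmorD ?pi ?qj ?pj ?qi ?pq ?fmor1 ?fmor0.
Qed.

Lemma Spc_map_prime (P : Spc L) : prime_tt_ideal (F @^-1` spc_set P).
Proof.
have pP := spcP P; split=> [|| X Y] /=.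
- split=> /=.
  + by move=> Z /fmor_zero; exact: (ideal_zero pP).
  + move=> X; rewrite (ideal_iso pP (fsusp_iso F X)); exact: (ideal_susp pP).
  + by move=> X Y Z f g h /(fmor_exact F); exact: (ideal_cone pP).
  + by move=> X Y /fmor_summand; exact: (ideal_summand pP).
  + move=> X Y PY; apply/(ideal_iso pP (ftens_iso F X Y)).
    exact: (ideal_tens pP).
- have [X PX] := prime_proper pP; exists unit => /=.
  move=> /(ideal_iso pP (funit_iso F)) P1; apply: PX.
  by apply/(ideal_iso pP (runit_iso X)); exact: (ideal_tens pP).
- by move=> /(ideal_iso pP (ftens_iso F X Y)); exact: (prime_tens pP).
Qed.

Definition Spc_map (P : Spc L) : Spc K := MkSpc (Spc_map_prime P).

Lemma fmor_Eset X (f : hom X X) : Eset f -> Eset (fmor F f).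
Proof.
move=> Ef; apply: (iso_monic (ftens_iso F X X)).
by rewrite -fmor1 !ftens_nat Ef.
Qed.

Definition Epair_map (Phi : tens_closed K) (Psi : tens_closed L)
    (FPhi : F @` Phi `<=` Psi) (x : Epair Phi) : Epair Psi :=
  MkEpair (FPhi _ (imageP F (pobP x))) (fmor_Eset (pendP x)).

End Functor.

(* Main.v *)
Require Import Defs.
From HB Require Import structures.
From mathcomp Require Import all_boot all_order all_algebra.
From mathcomp Require Import all_classical.
From mathcomp Require Import topology.

(* Given an ultrafilter on a set of prime ideals (of rings or of categories), the
   elements contained in almost all of these primes again form a prime ideal.
   Hence on each of the four spaces every ultrafilter has a canonical limit
   point, lying in exactly those basic opens that belong to the ultrafilter.
   Quasi-compactness and soberness follow, and a map is spectral as soon as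
   preimages of basic opens are basic opens. *)

Import GRing.Theory.
(* Restores [hom], shadowed by the one of MathComp's vector theory. *)
Import Defs.

Local Open Scope classical_set_scope.
Local Open Scope ring_scope.
Local Open Scope tt_scope.

(** * Ultrafilter criteria for spectral spaces and spectral maps *)

Lemma ultra_fmap {T U : Type} (f : T -> U) (G : set_system T) :
  UltraFilter G -> UltraFilter (f @ G).
Proof.
move=> UG; split; first exact: fmap_proper_filter.
move=> H PH GH; apply/seteqP; split=> // A HA.
(* Otherwise [H] would contain both [A] and its complement. *)
have [//|GA] := in_ultra_setVsetC (f @^-1` A) UG.
exfalso; apply: (@filter_not_empty _ H); rewrite -(setICr A).
by apply: filterI => //; exact: GH.
Qed.

Section UltraBasis.
Context {T : topologicalType} {I : Type} (D : I -> set T).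

(** The condition in [ub_lim] is convergence in the patch topology, generated by the sets [D i] and
    their complements: the field says that this topology is compact. [ub_inj] is the T0 axiom. *)
Record ultra_basis : Prop := UltraBasis {
  ub_open : forall i, open (D i);
  ub_basis : forall (U : set T) x, open U -> U x ->
    exists2 i, D i x & D i `<=` U;
  ub_setT : exists i, D i = setT;
  ub_setI : forall i j, exists k, D k = D i `&` D j;
  ub_inj : forall x y, (forall i, D i x <-> D i y) -> x = y;
  ub_lim : forall G : set_system T, UltraFilter G ->
    exists x, forall i, G (D i) <-> D i x
}.

Hypothesis bD : ultra_basis.

Lemma ub_nbhs {x : T} {B : set T} : nbhs x B -> exists2 i, D i x & D i `<=` B.
Proof.
rewrite nbhsE => -[U [oU Ux] UB].
have [i Dx DU] := ub_basis bD _ _ oU Ux.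
by exists i => //; exact: subset_trans UB.
Qed.

Lemma ub_lim_cvg {G : set_system T} {x : T} : UltraFilter G ->
  (forall i, G (D i) <-> D i x) -> G --> x.
Proof.
move=> UG Gx B /ub_nbhs[i Dx DB]; apply: (filterS DB); exact/Gx.
Qed.

(* [x] need not be the limit given by compactness, but it specializes to it. *)
Lemma ub_lim_qc {U : set T} {G : set_system T} {x : T} :
  qc_open U -> UltraFilter G -> (forall i, G (D i) <-> D i x) -> G U -> U x.
Proof.
move=> [oU]; rewrite compact_ultra => cU UG Gx GU.
have [y [Uy Gy]] := cU _ UG GU; have [i Diy DU] := ub_basis bD _ _ oU Uy.
apply: DU; apply/Gx; apply: Gy.
by apply: open_nbhs_nbhs; split => //; exact: ub_open.
Qed.

(** A patch-closed set is quasi-compact, since a patch limit is also a limit in the coarser given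
    topology. *)
Lemma ub_compact (U : set T) :
  (forall (G : set_system T) x, UltraFilter G ->
    (forall i, G (D i) <-> D i x) -> G U -> U x) -> compact U.
Proof.
move=> limU; rewrite compact_ultra => G UG GU; have [x Gx] := ub_lim bD _ UG.
by exists x; split; [exact: (limU G)|exact: ub_lim_cvg].
Qed.

Lemma ub_qc_open i : qc_open (D i).
Proof. by split; [exact: ub_open|apply: ub_compact => G x _ ->]. Qed.

(** By irreducibility the traces on [C] of the basic opens meeting it form a filter base; the
    canonical limit of an ultrafilter refining it is generic. *)
Lemma ub_generic_point (C : set T) : irreducible_closed C ->
  exists x, closure [set x] = C.
Proof.
move=> [cC [c Cc] irrC].
pose J := [set i | D i `&` C !=set0].
have FF : ProperFilter (filter_from J (fun i => D i `&` C)).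
  apply: filter_from_proper; last by move=> i; apply.
  apply: filter_from_filter.
    by have [i Di] := ub_setT bD; exists i; exists c; rewrite Di.
  move=> i j Ji Jj; have [k Dk] := ub_setI bD i j.
  exists k; last by rewrite Dk => x [[? ?] ?].
  (* If [D i] and [D j] had no common point in [C], their complements would cover [C], so one of
     them would contain it. *)
  apply: contrapT => Jk; have := irrC (~` D i) (~` D j).
  case; [exact/open_closedC/(ub_open bD)|exact/open_closedC/(ub_open bD)|..].
  - move=> x Cx; apply/not_andP => -[Dix Djx]; apply: Jk.
    by exists x; rewrite Dk.
  - by move=> CD; have [x [Dx Cx]] := Ji; exact: CD Dx.
  - by move=> CD; have [x [Dx Cx]] := Jj; exact: CD Dx.
have [G [UG FG]] := ultraFilterLemma FF.
have GC i : J i -> G (D i `&` C) by move=> Ji; apply: FG; exists i.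
have [x Gx] := ub_lim bD G UG; exists x.
(* Otherwise [G] would contain both [C] and a basic open disjoint from it. *)
have Cx : C x.
  apply: contrapT => nCx.
  have [i Dx DC] := ub_basis bD _ _ (closed_openC cC) nCx.
  have GD : G (D i) by exact/Gx.
  have Gc : G C.
    have [j Dj] := ub_setT bD.
    by apply: filterS (GC j _) => [y []//|]; exists c; rewrite Dj.
  apply: (@filter_not_empty _ G); apply: filterS (filterI GD Gc).
  by move=> y [/DC].
apply/seteqP; split.
  by rewrite closureE => y; apply; split=> // _ ->.
(* A basic neighbourhood of [y] meets [C], so it belongs to [G] and therefore contains [x]. *)
move=> y Cy B /ub_nbhs[i Dy DB]; exists x; split=> //; apply: DB; apply/Gx.
by apply: filterS (GC i _) => [z []//|]; exists y.
Qed.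

(** A basic open containing a point of the closure of [w] contains [w]; hence equal closures give
    the same basic opens. *)
Lemma ub_closure_inj (x y : T) : closure [set x] = closure [set y] -> x = y.
Proof.
have sub (z w : T) : closure [set z] = closure [set w] ->
    forall i, D i z -> D i w.
  move=> zw i Dz; have : closure [set w] z by rewrite -zw; exact: subset_closure.
  by case/(_ (D i)); [exact: open_nbhs_nbhs (conj (ub_open bD i) Dz)|move=> _ [->]].
by move=> xy; apply: (ub_inj bD) => i; split; apply: sub.
Qed.

Lemma ub_spectral_space : spectral_space T.
Proof.
split.
- exact: ub_compact.
- move=> U V qU qV; split; first by apply: openI; [case: qU|case: qV].
  apply: ub_compact => G x UG Gx GUV.
  by split; [apply: (ub_lim_qc qU UG Gx)|apply: (ub_lim_qc qV UG Gx)];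
    apply: filterS GUV => y [].
- move=> U x oU Ux; have [i Dx DU] := ub_basis bD _ _ oU Ux.
  by exists (D i); split=> //; exact: ub_qc_open.
- move=> C /ub_generic_point[x xC]; exists x; split=> // y yC.
  by apply: ub_closure_inj; rewrite xC.
Qed.

End UltraBasis.

(** If [x] is the canonical limit of [G], then [f x] is that of [f @ G], so preimages of
    quasi-compact opens contain their canonical limits. *)
Lemma ub_spectral_map {T T' : topologicalType} {I I' : Type}
    {D : I -> set T} {D' : I' -> set T'} (f : T -> T') (phi : I' -> I) :
  ultra_basis D -> ultra_basis D' -> (forall i, f @^-1` D' i = D (phi i)) ->
  spectral_map f.
Proof.
move=> bD bD' fD.
have f_cont : continuous f.
  move=> x B /(ub_nbhs _ bD')[i Dx DB]; apply: filterS (preimage_subset DB) _.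
  apply: open_nbhs_nbhs; split; last exact: Dx.
  by rewrite -/(f @^-1` D' i) fD; exact: (ub_open _ bD).
split=> // U qU; split; first by apply: open_comp => //; case: qU.
apply: (ub_compact _ bD) => G x UG Gx GU.
apply: (ub_lim_qc _ bD' (G := f @ G) qU _ _ GU).
  exact: ultra_fmap.
by move=> i; rewrite -[(f @ G) _]/(G (f @^-1` D' i)) fD Gx -fD.
Qed.

(** * Spectra of commutative rings *)

Section SpecSpectral.
Context {R : comPzRingType}.

Definition Spec_D (r : R) : set (Spec R) := [set p | ~ spec_set p r].

Lemma Spec_ext (p q : Spec R) : spec_set p = spec_set q -> p = q.
Proof.
case: p q => [p Pp] [q Pq] /= pq; subst q.
by rewrite (Prop_irrelevance Pp Pq).
Qed.

Lemma Spec_ub : ultra_basis Spec_D.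
Proof.
split.
- move=> r; exists [set r]; by rewrite bigcup_set1.
- by move=> U x [S ->] [r Sr xr]; exists r => // y yr; exists r.
- exists 1; rewrite -subTset => p _; exact: (pideal1 (specP p)).
- move=> r s; exists (r * s); apply/seteqP; split=> p /=.
    move=> prs; split=> [pr|ps]; apply: prs.
      by rewrite mulrC; exact: (pidealMl (specP p)).
    exact: (pidealMl (specP p)).
  by move=> [pr ps] /(pidealM (specP p))[].
- move=> p q pq; apply/Spec_ext/seteqP.
  by split=> r pr; apply: contrapT; [move/(pq r).2|move/(pq r).1]; apply.
- move=> G UG; pose S := [set r | G [set p | spec_set p r]].
  suff pS : prime_ring_ideal S.
    exists (MkSpec pS) => r; rewrite /Spec_D /=; split.
      move=> Gnr Gr; apply: (@filter_not_empty _ G).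
      by apply: filterS (filterI Gnr Gr) => p [].
    by move=> Gr; have [/Gr|] := in_ultra_setVsetC [set p | spec_set p r] UG.
  split; rewrite /S /=.
  + by apply: filterE => p; exact: (pideal0 (specP p)).
  + move=> r s Gr Gs; apply: filterS (filterI Gr Gs) => p [].
    exact: (pidealD (specP p)).
  + by move=> r s; apply: filterS => p; exact: (pidealMl (specP p)).
  + move=> G1; apply: (@filter_not_empty _ G); apply: filterS G1 => p.
    exact: (pideal1 (specP p)).
  + move=> r s Grs.
    (* If [r] is not in almost all primes, then almost all primes omit it and must contain [s]. *)
    have [|Gr] := in_ultra_setVsetC [set p | spec_set p r] UG; first by left.
    right; apply: filterS (filterI Grs Gr) => p [/(pidealM (specP p))[]] //.
Qed.

End SpecSpectral.

(** * Spectra of tensor triangulated categories and their subspaces [Zset Phi] *)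

Section SpcSpectral.
Context {K : tt_category}.

Lemma Spc_ext (P Q : Spc K) : spc_set P = spc_set Q -> P = Q.
Proof.
case: P Q => [P pP] [Q pQ] /= PQ; subst Q.
by rewrite (Prop_irrelevance pP pQ).
Qed.

(** [prime_proper] gives an object depending on [P]; properness of a limit of primes needs one
    object lying outside all of them. *)
Lemma prime_unit {P : set K} : prime_tt_ideal P -> ~ P unit.
Proof.
move=> pP P1; have [X] := prime_proper pP; apply.
by apply/(ideal_iso pP (runit_iso X)); exact: (ideal_tens pP).
Qed.

Lemma Spc_lim_prime (G : set_system (Spc K)) : UltraFilter G ->
  prime_tt_ideal [set X | G [set P | spc_set P X]].
Proof.
move=> UG; split.
- split=> /=.
  + by move=> Z Z0; apply: filterE => P; exact: (ideal_zero (spcP P)).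
  + by move=> X; split; apply: filterS => P; move/(ideal_susp (spcP P)).
  + move=> X Y Z f g h D GX GY; apply: filterS (filterI GX GY) => P [].
    exact: (ideal_cone (spcP P) D).
  + by move=> X Y XY; apply: filterS => P; exact: (ideal_summand (spcP P) XY).
  + by move=> X Y; apply: filterS => P; exact: (ideal_tens (spcP P)).
- exists unit => G1; apply: (@filter_not_empty _ G); apply: filterS G1 => P.
  exact: prime_unit (spcP P).
- move=> X Y /= GXY.
  have [|GX] := in_ultra_setVsetC [set P : Spc K | spc_set P X] UG.
    by left.
  by right; apply: filterS (filterI GXY GX) => P [/(prime_tens (spcP P))[]].
Qed.

Context (Phi : set K).

(** Supports are closed here, so a basic open asks for membership of [X], opposite to [Spec_D]. *)
Definition Zset_D (X : K) : set (Zset Phi) := [set P | spc_set (set_val P) X].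

Lemma Zset_ub : ultra_basis Zset_D.
Proof.
split.
- move=> X; exists (~` supp X).
    by exists [set X]; rewrite bigcup_set1.
  by apply/seteqP; split=> P /=; [move/contrapT|move=> PX; apply].
- move=> _ x [V [S ->] <-] [X SX xX]; exists X; first exact: contrapT.
  by move=> Q QX; exists X => //; apply.
- have [O ZO] := has_zero_object K; exists O; rewrite -subTset => P _.
  exact: (ideal_zero (spcP _)).
(* The cone of the zero map is a sum of [Y] and the suspension of [X], so it lies in a thick ideal
   iff both [X] and [Y] do. *)
- move=> X Y; have [Z [g [h D]]] := dist_cone (0 : hom X Y); exists Z.
  by apply/seteqP; split=> P /(ideal_cone0 (spcP (set_val P)) D).
- move=> P Q PQ; apply/val_inj/Spc_ext/seteqP.
  by split=> X /PQ.
- move=> G UG.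
  have pS := Spc_lim_prime _ (ultra_fmap set_val G UG).
  (* An object of [Phi] lies in no prime of [Zset Phi], hence not in almost all of them. *)
  have ZS : Zset Phi (MkSpc pS).
    move=> X PhiX GX; apply: (@filter_not_empty _ G).
    by apply: filterS (GX : G (Zset_D X)) => P; exact: Zset_notin.
  by exists (SigSub (mem_set ZS)).
Qed.

End SpcSpectral.

(** * Functoriality of the tensor ring and naturality of [rho] *)

Section Naturality.
Context {K L : tt_category} (F : tt_functor K L).
Context {Phi : tens_closed K} {Psi : tens_closed L} (FPhi : F @` Phi `<=` Psi).

(** The isomorphism [ftens] matches the image of a generating step with a generating step over
    [Psi], and [Ecls_iso] makes isomorphic pairs equal. *)
Lemma Epair_map_eqv (x y : Epair Phi) : Epair_eqv x y ->
  Ecls (Epair_map FPhi x) = Ecls (Epair_map FPhi y).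
Proof.
elim=> {x y} [x _ [] a Pa|//|x y _ ->|x y z _ -> _ ->] //.
  have PFa := FPhi _ (imageP F Pa).
  rewrite -(Ecls_tensl PFa); apply: (@Ecls_iso _ Psi
    (Epair_tensl PFa (Epair_map FPhi x)) (Epair_map FPhi (Epair_tensl Pa x))
    _ (ftens_iso F a (pob x))) => /=.
  by rewrite -fmor1 ftens_nat.
have PFa := FPhi _ (imageP F Pa).
rewrite -(Ecls_tensr PFa); apply: (@Ecls_iso _ Psi
  (Epair_tensr PFa (Epair_map FPhi x)) (Epair_map FPhi (Epair_tensr Pa x))
  _ (ftens_iso F (pob x) a)) => /=.
by rewrite -fmor1 ftens_nat.
Qed.

Definition tensor_ring_map (r : tensor_ring Phi) : tensor_ring Psi :=
  Ecls (Epair_map FPhi (repr r)).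

Lemma tensor_ring_mapE (x : Epair Phi) :
  tensor_ring_map (Ecls x) = Ecls (Epair_map FPhi x).
Proof. exact/Epair_map_eqv/repr_eqv. Qed.

(** Representing both classes on a common object reduces the claim to additivity of [F] on
    endomorphisms. *)
Lemma tensor_ring_map_nmod : nmod_morphism tensor_ring_map.
Proof.
split.
  have [X PX] := tset_neq0 Phi.
  rewrite -(Ecls0 PX) tensor_ring_mapE -(Ecls0 (FPhi _ (imageP F PX))).
  by congr Ecls; apply: Epair_eq; exact: fmor0.
move=> r s; have [X [PX [f [g [Ef [Eg [_ -> ->]]]]]]] := common2_comm r s.
rewrite [_ + _]Ecls_add !tensor_ring_mapE [RHS]Ecls_add.
by congr Ecls; apply: Epair_eq; exact: fmorD.
Qed.

Lemma tensor_ring_map_monoid : monoid_morphism tensor_ring_map.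
Proof.
split.
  have [X PX] := tset_neq0 Phi.
  rewrite -(Ecls1 PX) tensor_ring_mapE -(Ecls1 (FPhi _ (imageP F PX))).
  by congr Ecls; apply: Epair_eq; exact: fmor1.
move=> r s; have [X [PX [f [g [Ef [Eg [_ -> ->]]]]]]] := common2_comm r s.
rewrite [_ * _]Ecls_mul !tensor_ring_mapE [RHS]Ecls_mul.
by congr Ecls; apply: Epair_eq; exact: fmorM.
Qed.

HB.instance Definition _ := GRing.isNmodMorphism.Build
  (tensor_ring Phi) (tensor_ring Psi) tensor_ring_map tensor_ring_map_nmod.
HB.instance Definition _ := GRing.isMonoidMorphism.Build
  (tensor_ring Phi) (tensor_ring Psi) tensor_ring_map tensor_ring_map_monoid.

(** Exactness makes the image of [cone f] a cone of [fmor F f], and membership in a thick ideal does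
    not depend on the chosen cone. *)
Lemma cone_fmor (P : Spc L) {X Y : K} (f : hom X Y) :
  spc_set P (cone (fmor F f)) <-> spc_set P (F (cone f)).
Proof.
have [g [h D]] := cone_dist f.
exact: (ideal_coneE (spcP P) (fmor_exact F D)).
Qed.

Lemma Zset_Spc_map (P : Spc L) : Zset Psi P -> Zset Phi (Spc_map F P).
Proof. by move=> ZP X PX; apply: ZP; apply: FPhi; exists X. Qed.

Definition Zset_map (P : Zset Psi) : Zset Phi :=
  SigSub
    (mem_set (Zset_Spc_map (set_val P) (set_mem (valP P)))).

Lemma rho_natural (P : Zset Psi) :
  rho (Zset_map P) = Spec_map tensor_ring_map (rho P).
Proof.
apply/Spec_ext/funext => r; apply/propext; rewrite -[r]Ecls_repr.
apply: (iff_trans (rho_setE (spcP (set_val (Zset_map P)))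
  (@Zset_notin _ _ (Zset_map P)) _)).
rewrite /= /preimage /= tensor_ring_mapE.
apply: iff_sym.
apply: (iff_trans (rho_setE (spcP (set_val P)) (@Zset_notin _ _ P) _)).
exact/not_iff_compat/cone_fmor.
Qed.

End Naturality.

(** The class of [f] lies outside [rho P] exactly when [cone f] lies in [P], so the preimage of its
    basic open is the basic open of [cone f]. *)
Lemma rho_spectral {K : tt_category} (Phi : tens_closed K) :
  spectral_map (@rho K Phi).
Proof.
apply: (ub_spectral_map (@rho K Phi) (fun r => cone (pend (repr r)))
  (Zset_ub Phi) Spec_ub).
move=> r; apply/funext => P; apply/propext; rewrite -{1}[r]Ecls_repr.
apply: (iff_trans (not_iff_compat
  (rho_setE (spcP (set_val P)) (@Zset_notin _ _ P) _))).
by split=> [/contrapT|? ?].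
Qed.

Theorem proposition4p19 (K L : tt_category) (F : tt_functor K L)
    (Phi : tens_closed K) (Psi : tens_closed L) (FPhi : F @` Phi `<=` Psi) :
  (forall P : Spc L, Zset Psi P -> Zset Phi (Spc_map F P)) /\
  exists (F_Z : Zset Psi -> Zset Phi)
         (F_R : {rmorphism tensor_ring Phi -> tensor_ring Psi}),
    [/\ forall P : Zset Psi, set_val (F_Z P) = Spc_map F (set_val P),
        forall x : Epair Phi, F_R (Ecls x) = Ecls (Epair_map FPhi x),
        [/\ spectral_space (Zset Psi), spectral_space (Zset Phi),
            spectral_space (Spec (tensor_ring Psi))
          & spectral_space (Spec (tensor_ring Phi))],
        [/\ spectral_map F_Z, spectral_map (Spec_map F_R),
            spectral_map (@rho L Psi) & spectral_map (@rho K Phi)]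
      & forall P : Zset Psi, rho (F_Z P) = Spec_map F_R (rho P)].
Proof.
split; first exact: Zset_Spc_map.
exists (Zset_map F FPhi), (tensor_ring_map F FPhi); split.
- by [].
- exact: tensor_ring_mapE.
- by split; apply: ub_spectral_space (Zset_ub _) || apply: ub_spectral_space Spec_ub.
- split; [| |exact: rho_spectral..].
  (* By definition the preimage of [Zset_D X] is [Zset_D (F X)]. *)
  + by apply: (ub_spectral_map _ F (Zset_ub Psi) (Zset_ub Phi)).
  + by apply: (ub_spectral_map _ (tensor_ring_map F FPhi) Spec_ub Spec_ub).
- exact: rho_natural.
Qed.
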